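(* Let $a=\sum_{n\in\mathbb{Z},\,n\equiv1\pmod 3}x^{n^2}\in\mathbb{Z}/2[[x]]$ and let $B(a)$ be the set of integers $n$ such that the coefficient of $x^n$ in the Laurent series $1/a$ is $1$. Suppose $n\equiv 3\pmod 8$ and $n\in B(a)$. Then the number of pairs $(s_1,s_2)$ of perfect squares with $s_1+2s_2=n$ is odd. Furthermore, $n$ is the product of a prime and a square.
   Context: $1/a$ is computed in the field of Laurent series over $\mathbb{Z}/2$. *)

(* Defs.v *)
From HB Require Import structures.
From mathcomp Require Import all_boot all_order all_algebra.
From mathcomp Require Import zify.
From mathcomp Require Import finmap mathcomp_extra boolp classical_sets.
From mathcomp Require Import functions cardinality fsbigop.

Set Implicit Arguments.
Unset Strict Implicit.
Unset Printing Implicit Defensive.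

Import Order.TTheory GRing.Theory Num.Theory.

Local Open Scope classical_set_scope.
Local Open Scope ring_scope.

Definition bounded_below (F : fieldType) (f : int -> F) : Prop :=
  exists N : int, forall n : int, n < N -> f n = 0.

(* Formal Laurent series over F. [coefl f n] is the coefficient of x^n in f. *)
Record laurent (F : fieldType) : Type := Laurent {
  coefl : int -> F;
  _ : `[< bounded_below coefl >] }.

Section LaurentField.
Variable F : fieldType.
Implicit Types (f g h : laurent F) (m n : int).

HB.instance Definition _ := [isSub for @coefl F].
HB.instance Definition _ := [Choice of laurent F by <:].

Lemma coeflP f : exists N : int, forall n, n < N -> coefl f n = 0.
Proof. by case: f => f /= /asboolP. Qed.

Lemma laurent_eq f g : coefl f =1 coefl g -> f = g.
Proof. by move=> fg; apply/val_inj/funext. Qed.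

Definition mkLaurent (c : int -> F) (hc : bounded_below c) : laurent F :=
  Laurent (asboolT hc).

Lemma laurent0_subproof : bounded_below (fun=> 0 : F).
Proof. by exists 0. Qed.
Definition laurent0 := mkLaurent laurent0_subproof.

Lemma laurent1_subproof : bounded_below (fun n : int => (n == 0)%:R : F).
Proof. by exists 0 => n; case: eqP => // ->. Qed.
Definition laurent1 := mkLaurent laurent1_subproof.

Lemma oppl_subproof f : bounded_below (fun n => - coefl f n).
Proof. by have [N fN] := coeflP f; exists N => n /fN ->; rewrite oppr0. Qed.
Definition oppl f := mkLaurent (oppl_subproof f).

Lemma addl_subproof f g : bounded_below (fun n => coefl f n + coefl g n).
Proof.
have [M fM] := coeflP f; have [N gN] := coeflP g.
exists (Num.min M N) => n; rewrite lt_min => /andP[/fM -> /gN ->].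
exact: addr0.
Qed.
Definition addl f g := mkLaurent (addl_subproof f g).

(* The sum has finite support, since f and g are bounded below. *)
Definition mull_coef f g n : F :=
  \sum_(i \in [set: int]) coefl f i * coefl g (n - i).

Lemma mull_coefE f g M N (k : nat) :
    (forall n, n < M -> coefl f n = 0) -> (forall n, n < N -> coefl g n = 0) ->
  mull_coef f g (M + N + k%:Z) =
  \sum_(i < k.+1) coefl f (M + i%:Z) * coefl g (N + (k - i)%N%:Z).
Proof.
move=> fM gN; rewrite /mull_coef.
pose r := [seq M + i%:Z | i <- iota 0 k.+1].
rewrite (fsbigE r).
- rewrite (eq_bigl xpredT); last by move=> i; rewrite in_setT.
  rewrite big_map -[iota _ _]/(index_iota 0 k.+1) big_mkord.
  apply: eq_bigr => i _; congr (_ * coefl g _).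
  by have := ltn_ord i; lia.
- by rewrite map_inj_uniq ?iota_uniq // => i j; lia.
- by [].
- move=> i _ ir; have [/fM -> | Mi] := ltP i M; first exact: mul0r.
  rewrite gN ?mulr0 // ltNge; apply: contraNN ir => le_i.
  apply/mapP; exists `|i - M|%N; last by lia.
  by rewrite mem_iota; lia.
Qed.

Lemma mull_coef0 f g M N n :
    (forall n, n < M -> coefl f n = 0) -> (forall n, n < N -> coefl g n = 0) ->
  n < M + N -> mull_coef f g n = 0.
Proof.
move=> fM gN nMN; apply: fsbig1 => i _.
have [/fM -> | Mi] := ltP i M; first exact: mul0r.
by rewrite gN ?mulr0 //; lia.
Qed.

Lemma mull_subproof f g : bounded_below (mull_coef f g).
Proof.
have [M fM] := coeflP f; have [N gN] := coeflP g.
by exists (M + N) => n; exact: mull_coef0.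
Qed.
Definition mull f g := mkLaurent (mull_subproof f g).

(* Truncations of x^(-M) f, used to transport the ring axioms from {poly F}. *)
Let T (M : int) k f : {poly F} := \poly_(i < k) coefl f (M + i%:Z).

Lemma coefTM f g M N (k j : nat) :
    (forall n, n < M -> coefl f n = 0) -> (forall n, n < N -> coefl g n = 0) ->
  (j < k)%N -> coefl (mull f g) (M + N + j%:Z) = (T M k f * T N k g)`_j.
Proof.
move=> fM gN jk; rewrite /= mull_coefE // coefM; apply: eq_bigr => i _.
by rewrite !coef_poly !ifT //; have := ltn_ord i; lia.
Qed.

Lemma eq_coefM (p p' q q' : {poly F}) k :
    (forall i, (i <= k)%N -> p`_i = p'`_i) ->
    (forall i, (i <= k)%N -> q`_i = q'`_i) ->
  (p * q)`_k = (p' * q')`_k.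
Proof.
move=> pp' qq'; rewrite !coefM; apply: eq_bigr => i _.
by rewrite pp' ?qq' // ?leq_subr // -ltnS.
Qed.

Lemma ltz_split M n : n < M \/ exists k : nat, n = M + k%:Z.
Proof. by have [|Mn] := ltP n M; [left | right; exists `|n - M|%N; lia]. Qed.

Lemma addlA : associative addl.
Proof. by move=> f g h; apply: laurent_eq => n /=; rewrite addrA. Qed.
Lemma addlC : commutative addl.
Proof. by move=> f g; apply: laurent_eq => n /=; rewrite addrC. Qed.
Lemma add0l : left_id laurent0 addl.
Proof. by move=> f; apply: laurent_eq => n /=; rewrite add0r. Qed.
Lemma addNl : left_inverse laurent0 oppl addl.
Proof. by move=> f; apply: laurent_eq => n /=; rewrite addNr. Qed.

Lemma mullC : commutative mull.
Proof.
move=> f g; have [M fM] := coeflP f; have [N gN] := coeflP g.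
apply: laurent_eq => n; have [nMN|[k ->]] := ltz_split (M + N) n.
  by rewrite /= (mull_coef0 fM gN) // (mull_coef0 gN fM) // addrC.
rewrite (coefTM fM gN (ltnSn k)) mulrC -(coefTM gN fM (ltnSn k)).
by rewrite (addrC M).
Qed.

Lemma mullA : associative mull.
Proof.
move=> f g h; have [M fM] := coeflP f; have [N gN] := coeflP g.
have [L hL] := coeflP h.
have fgMN n : n < M + N -> coefl (mull f g) n = 0 by exact: mull_coef0.
have ghNL n : n < N + L -> coefl (mull g h) n = 0 by exact: mull_coef0.
apply: laurent_eq => n; have [nMN|[k ->]] := ltz_split (M + N + L) n.
  rewrite /= (mull_coef0 fM ghNL) ?addrA //.
  by rewrite (mull_coef0 fgMN hL).
rewrite (coefTM fgMN hL (ltnSn k)) -(addrA M N L) (coefTM fM ghNL (ltnSn k)).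
rewrite (@eq_coefM _ (T M k.+1 f) _ (T N k.+1 g * T L k.+1 h)) //; last first.
  by move=> i ik; rewrite coef_poly ltnS ik (@coefTM _ _ _ _ k.+1).
rewrite mulrA; apply: eq_coefM => // i ik.
by rewrite coef_poly ltnS ik (@coefTM _ _ _ _ k.+1).
Qed.

Lemma mul1l : left_id laurent1 mull.
Proof.
move=> f; have [N fN] := coeflP f.
have oneN n : n < 0 -> coefl laurent1 n = 0 by rewrite /=; case: eqP => // ->.
apply: laurent_eq => n; have [nN|[k ->]] := ltz_split N n.
  by rewrite fN //= (mull_coef0 oneN fN) // add0r.
rewrite -[in LHS](add0r N) /= (mull_coefE _ oneN fN) big_ord_recl /=.
rewrite mul1r subn0 big1 ?addr0 // => i _.
by rewrite /bump /= mul0r.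
Qed.

Lemma mullDl : left_distributive mull addl.
Proof.
move=> f g h; have [M fM] := coeflP f; have [N gN] := coeflP g.
have [L hL] := coeflP h; pose K := Num.min M N.
have fK n : n < K -> coefl f n = 0.
  by rewrite lt_min => /andP[/fM].
have gK n : n < K -> coefl g n = 0.
  by rewrite lt_min => /andP[_ /gN].
have fgK n : n < K -> coefl (addl f g) n = 0.
  by move=> nK; rewrite /= fK // gK // addr0.
apply: laurent_eq => n; have [nK|[k ->]] := ltz_split (K + L) n.
  by rewrite /= (mull_coef0 fgK hL) // (mull_coef0 fK hL) //
    (mull_coef0 gK hL) ?addr0.
rewrite /= (mull_coefE _ fgK hL) (mull_coefE _ fK hL) (mull_coefE _ gK hL).
by rewrite -big_split; apply: eq_bigr => i _; rewrite mulrDl.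
Qed.

Lemma laurent1_neq0 : laurent1 != laurent0.
Proof.
apply/eqP => /(congr1 (fun f => coefl f 0)) /=.
by move/eqP; rewrite oner_eq0.
Qed.

HB.instance Definition _ :=
  GRing.isZmodule.Build (laurent F) addlA addlC add0l addNl.
HB.instance Definition _ := GRing.Zmodule_isComNzRing.Build (laurent F)
  mullA mullC mul1l mullDl laurent1_neq0.

Definition invl f : laurent F := xget 0 [set g : laurent F | g * f = 1].

(* Coefficients 0, ..., k-1 of the inverse of the power series with
   coefficients u, when u 0 != 0. *)
Fixpoint invs (u : nat -> F) (k : nat) : seq F :=
  if k is k'.+1 then
    rcons (invs u k')
      ((u 0)^-1 * ((k' == 0)%:R - \sum_(i < k') (invs u k')`_i * u (k' - i)%N))
  else [::].

Lemma size_invs u k : size (invs u k) = k.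
Proof. by elim: k => //= k IHk; rewrite size_rcons IHk. Qed.

Lemma nth_invs u k i : (i < k)%N -> (invs u k)`_i = (invs u i.+1)`_i.
Proof.
elim: k => // k IHk; rewrite ltnS leq_eqVlt => /orP[/eqP -> //|ik].
by rewrite [LHS]/= nth_rcons size_invs ik IHk.
Qed.

Lemma invsP u k : u 0%N != 0 ->
  \sum_(i < k.+1) (invs u i.+1)`_i * u (k - i)%N = (k == 0)%:R.
Proof.
move=> u0; rewrite big_ord_recr /= nth_rcons size_invs ltnn eqxx subnn.
rewrite mulrAC mulVf // mul1r.
rewrite [X in X + _](eq_bigr (fun i : 'I_k => (invs u k)`_i * u (k - i)%N)).
  by rewrite addrC subrK.
by move=> i _; rewrite [in RHS]nth_invs.
Qed.

Lemma laurent_order f : f != 0 ->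
  exists M, coefl f M != 0 /\ forall n, n < M -> coefl f n = 0.
Proof.
move=> f0; have [N fN] := coeflP f.
have exk : exists k : nat, coefl f (N + k%:Z) != 0.
  apply: contrapT => /forallNP nk; move/eqP: f0; apply.
  apply: laurent_eq => n; have [/fN -> //|[k ->]] := ltz_split N n.
  by apply/eqP; apply: contra_notT (nk k).
have := ex_minnP exk => -[k fk mink].
exists (N + k%:Z); split=> // n nk.
have [/fN //|[j nj]] := ltz_split N n.
rewrite nj; apply/eqP; apply: contraT; rewrite -nj nj => /mink; lia.
Qed.

Lemma invl_ex f : f != 0 -> exists g, g * f = 1.
Proof.
move=> /laurent_order[M [fM0 fM]].
pose u (i : nat) := coefl f (M + i%:Z).
pose c n : F := if 0 <= n + M then (invs u (absz (n + M)).+1)`_(absz (n + M)) else 0.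
have cM n : n < - M -> c n = 0 by move=> nM; rewrite /c ifF //; lia.
have hc : bounded_below c by exists (- M).
exists (mkLaurent hc); apply: laurent_eq => n.
have [nM|[k ->]] := ltz_split (- M + M) n.
  rewrite [LHS](@mull_coef0 (mkLaurent hc) f (- M) M) //=.
  by move: nM; rewrite addNr; case: eqP => // ->.
rewrite [LHS](@mull_coefE (mkLaurent hc) f (- M) M) //.
rewrite [RHS]/= addNr add0r -[RHS]/((k == 0)%:R) -(@invsP u) /u ?addr0 //.
apply: eq_bigr => i _ /=; rewrite /c.
have -> : - M + i%:Z + M = i%:Z by lia.
by [].
Qed.

Lemma mulVl f : f != 0 -> invl f * f = 1.
Proof. by move=> /invl_ex; exact: xgetPex. Qed.

Lemma invl0 : invl 0 = 0.
Proof.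
rewrite /invl; case: xgetP => // g _ /=; rewrite mulr0 => /esym/eqP.
by rewrite oner_eq0.
Qed.

HB.instance Definition _ := GRing.ComNzRing_isField.Build (laurent F) mulVl invl0.

End LaurentField.

Definition theta_coef (m : int) : 'F_2 :=
  \sum_(n \in [set n : int | (n = 1 %[mod 3])%Z]) ((m == n ^+ 2)%:R : 'F_2).

Lemma theta_coef_bounded : bounded_below theta_coef.
Proof.
exists 0 => m m0; apply: fsbig1 => n _.
by case: eqP => // mn; move: m0; rewrite mn ltNge sqr_ge0.
Qed.

(* The series a = \sum_(n = 1 mod 3) x^(n^2); its exponents are nonnegative. *)
Definition theta : laurent 'F_2 := mkLaurent theta_coef_bounded.

(* Sanity check: no two exponents n^2 in the sum defining theta coincide. *)
Lemma theta_coefE (m : int) :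
  coefl theta m = `[< exists n : int, (n = 1 %[mod 3])%Z /\ m = n ^+ 2 >]%:R.
Proof.
rewrite /= /theta_coef; case: asboolP => [[n [n3 mn]]|nex].
  rewrite (fsbigE [:: n]) //=.
  - by rewrite big_cons big_nil ifT ?inE // mn eqxx addr0.
  - by move=> i /=; rewrite inE => /eqP ->.
  - move=> i i3; rewrite inE => /negPf ni; case: eqP => // mi.
    have := mi; rewrite mn => /eqP; rewrite eqf_sqr eq_sym ni /= => /eqP ein.
    by move: i3 n3 => /=; rewrite ein; lia.
by apply: fsbig1 => n /= n3; case: eqP => // mn; case: nex; exists n.
Qed.

Definition Bset (f : laurent 'F_2) : set int := [set n : int | coefl f^-1 n = 1].

Definition perfect_square (s : int) : Prop := exists k : int, s = k ^+ 2.

(* Main.v *)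
(* Write a = o + u with o the part of odd exponents; halving the even n gives
   u = a^4.  In 1/a = a^7/a^8 the exponents that are 3 mod 8 come only from the
   term o^3 u^4 of a^7 = (o + u)(o^2 + u^2)(o^4 + u^4), so that part of 1/a is
   o^3 a^8.  Moreover o a^8 is the sum of the x^(9k^2), k > 0 odd: its
   coefficients count elements of Z[sqrt(-2)], and removing the powers of a prime
   above 3 followed by conjugation pairs off all but the real ones.  Hence, for
   n = 3 mod 8, the coefficient is the parity of #{2i^2 + 9j^2 = n}, which is
   #{i^2 + 2j^2 = n} when n = 2 mod 3 and 0 otherwise.

   By Jackson's windmill involution on {x^2 + 2yz = n}, #{i^2 + 2j^2 = n} has the
   parity of the number of divisors d of n with d < n/d.  If p has odd exponent
   in n, exchanging the p-parts of d and n/d is an involution on these divisors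
   (up to replacing d by n/d); a fixed point makes n/p a square. *)
Require Import Defs.
From mathcomp Require Import all_boot all_order all_algebra.
From mathcomp Require Import finmap boolp classical_sets functions cardinality.
From mathcomp Require Import fsbigop zify ring.

Set Implicit Arguments.
Unset Strict Implicit.
Unset Printing Implicit Defensive.

Import Order.TTheory GRing.Theory Num.Theory.

Local Open Scope classical_set_scope.
Local Open Scope card_scope.
Local Open Scope ring_scope.

(** * Parity of finite lists under involutions, and bijections between lists *)

(** The points that [f] moves fall into pairs {x, f x}: the induction on the length drops the head
    if it is fixed, and otherwise the head together with its partner. *)
Lemma odd_size_involution (T : eqType) (f : T -> T) (s : seq T) :
    uniq s -> {in s, forall x, f x \in s} -> {in s, involutive f} ->
  odd (size s) = odd (size [seq x <- s | f x == x]).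
Proof.
have [m] := ubnP (size s); elim: m s => // m IHm [//|x s] /ltnSE /= lt_m.
case/andP=> xs us fs ff; have fx := ff x (mem_head _ _).
have fsE y : y \in s -> f y != x -> f y \in s.
  by move=> ys fyx; have := fs y; rewrite !inE ys orbT (negPf fyx); apply.
have ffs y : y \in s -> f (f y) = y by move=> ys; apply: ff; rewrite inE ys orbT.
case: eqP => [fxx | /eqP fxx] /=.
  congr (~~ _); apply: IHm => // y ys.
  apply: fsE => //; apply: contraNneq xs => fyx.
  by rewrite -fxx -fyx ffs.
have fx_s : f x \in s by have := fs x (mem_head _ _); rewrite inE (negPf fxx).
have /permP/(_ (fun y => f y == y)) := perm_to_rem fx_s.
rewrite !size_filter /= fx eq_sym (negPf fxx) add0n => ->.
rewrite (perm_size (perm_to_rem fx_s)) /= negbK -size_filter.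
have memr y : (y \in rem (f x) s) = (y != f x) && (y \in s) by rewrite mem_rem_uniq.
apply: IHm; rewrite ?rem_uniq //.
- by rewrite (leq_trans _ lt_m) // ltnS size_rem // leq_pred.
- move=> y; rewrite !memr => /andP[yfx ys]; rewrite fsE //.
    by rewrite andbT; apply: contraNneq xs => /(congr1 f); rewrite fx ffs // => <-.
  by apply: contraNneq yfx => <-; rewrite ffs.
- by move=> y; rewrite memr => /andP[_ /ffs].
Qed.

Lemma size_bijection (T U : eqType) (f : T -> U) (g : U -> T)
    (s : seq T) (t : seq U) :
    uniq s -> uniq t ->
    {in s, forall x, f x \in t} -> {in t, forall y, g y \in s} ->
    {in s, cancel f g} -> {in t, cancel g f} ->
  size s = size t.
Proof.
move=> us ut st ts fK gK; apply/eqP; rewrite eqn_leq; apply/andP; split.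
  rewrite -(size_map f) uniq_leq_size ?(map_inj_in_uniq (can_in_inj fK)) //.
  by move=> _ /mapP[x /st xt ->].
rewrite -(size_map g) uniq_leq_size ?(map_inj_in_uniq (can_in_inj gK)) //.
by move=> _ /mapP[x /ts xt ->].
Qed.

Lemma odd_size_subsingleton (T : eqType) (s : seq T) :
  uniq s -> {in s &, forall x y, x = y} -> odd (size s) = (s != [::]).
Proof.
case: s => [|x [|y s]] //= /andP[] + _ /(_ x y); rewrite !inE !eqxx orbT.
by move=> /norP[/eqP xy _] /(_ isT isT).
Qed.

(** * Finite boxes of integers, and squares modulo 8 *)

Definition irange (m : nat) : seq int := [seq i%:Z - m%:Z | i <- iota 0 m.*2.+1].

Lemma irange_uniq m : uniq (irange m).
Proof. by rewrite map_inj_uniq ?iota_uniq // => i j; lia. Qed.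

Lemma mem_irange m (x : int) : (x \in irange m) = (`|x| <= m%:Z).
Proof.
apply/mapP/idP => [[i] | xm]; first by rewrite mem_iota; lia.
by exists (absz (x + m%:Z)); [rewrite mem_iota|]; lia.
Qed.

Definition ibox (m : nat) : seq (int * int) := [seq (x, y) | x <- irange m, y <- irange m].

Lemma ibox_uniq m : uniq (ibox m).
Proof. by rewrite allpairs_uniq ?irange_uniq // => -[? ?] [? ?]. Qed.

Lemma mem_ibox m (x y : int) : ((x, y) \in ibox m) = (`|x| <= m%:Z) && (`|y| <= m%:Z).
Proof.
rewrite -!mem_irange; apply/allpairsP/andP => [[[i j] /= [? ? [-> ->]]] //|[? ?]].
by exists (x, y).
Qed.

Lemma odd_sqr_mod8 (k : nat) : odd k -> exists t, (k ^ 2 = 8 * t + 1)%N.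
Proof.
move=> ok; have [r kE] : exists r, (k = 2 * r + 1)%N by exists (k %/ 2)%N; lia.
have [t tE] : exists t, (r * (r + 1) = 2 * t)%N.
  exists (r * (r + 1) %/ 2)%N; have : ~~ odd (r * (r + 1)) by rewrite oddM; lia.
  by lia.
by exists t; rewrite kE; lia.
Qed.

Lemma nonsquare_mod8 n k : (n %% 8 = 3)%N -> n != (k ^ 2)%N.
Proof.
move=> n8; apply/eqP => nE; have [ok|ek] := boolP (odd k).
  by have [t tE] := odd_sqr_mod8 ok; lia.
by have : odd n by [lia]; rewrite nE oddX (negPf ek).
Qed.

(** * Parity of the number of positive solutions of x^2 + 2yz = n, computed with two involutions *)

Definition windmills (n : nat) : seq (int * (int * int)) :=
  [seq t <- [seq (x, p) | x <- irange n, p <- ibox n] |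
    [&& 0 < t.1, 0 < t.2.1, 0 < t.2.2 & t.1 ^+ 2 + 2 * t.2.1 * t.2.2 == n%:Z]].

Lemma windmills_uniq n : uniq (windmills n).
Proof.
by rewrite filter_uniq // allpairs_uniq ?irange_uniq ?ibox_uniq // => -[? ?] [? ?].
Qed.

Lemma mem_windmills n (x y z : int) :
  ((x, (y, z)) \in windmills n) =
  [&& 0 < x, 0 < y, 0 < z & x ^+ 2 + 2 * y * z == n%:Z].
Proof.
rewrite mem_filter andb_idr // => /and4P[];
  rewrite [_.1]/= [_.2.1]/= [_.2.2]/= => x0 y0 z0 /eqP xyz.
apply/allpairsP; exists (x, (y, z)); rewrite mem_irange mem_ibox; split=> //.
  by rewrite gtr0_norm //=; nia.
by rewrite !gtr0_norm //; apply/andP; split; nia.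
Qed.

(* T. Jackson's involution on {x^2 + 2yz = n}.  Equality in any of the four tests
   would contradict the oddness of x, y, z, and for n = 3 mod 8 its fixed points
   are the triples with x = y, that is, the factorizations n = x(x + 2z). *)
Definition jackson (t : int * (int * int)) : int * (int * int) :=
  let: (x, (y, z)) := t in
  if 2 * y < x then (x - 2 * y, (z + 2 * x - 2 * y, y))
  else if 2 * y < 2 * x + z then (2 * y - x, (y, 2 * x - 2 * y + z))
  else if 2 * y < 3 * x + 2 * z then
    (3 * x - 2 * y + 2 * z, (2 * x - y + 2 * z, - 2 * x + 2 * y - z))
  else if y < 2 * x + 2 * z then
    (- 3 * x + 2 * y - 2 * z, (- 2 * x + 2 * y - z, 2 * x - y + 2 * z))
  else (x + 2 * z, (z, - 2 * x + y - 2 * z)).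

(** Since n is odd, so is x. Then x^2 = 1 mod 8, hence 2yz = 2 mod 8 and yz is odd. *)
Lemma windmill_odd n x y z : (n %% 8 = 3)%N -> x ^+ 2 + 2 * y * z = n%:Z ->
  [/\ (x %% 2 = 1)%Z, (y %% 2 = 1)%Z & (z %% 2 = 1)%Z].
Proof.
move=> n8 xyz.
have split2 (u : int) : exists i b : int, u = 2 * i + b /\ (b = 0 \/ b = 1).
  by exists (u %/ 2)%Z, (u %% 2)%Z; lia.
have [i [b [xE b01]]] := split2 x.
have [j [c [yE c01]]] := split2 y.
have [k [d [zE d01]]] := split2 z.
have [e nE] : exists e : int, n%:Z = 8 * e + 3 by exists (n %/ 8)%N; lia.
move: b01 c01 d01 xyz => [bE|bE] [cE|cE] [dE|dE]; rewrite nE xE yE zE bE cE dE => xyz.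
all: try by split; lia.
all: exfalso; nia.
Qed.

Lemma jackson_windmills n : (n %% 8 = 3)%N ->
  {in windmills n, forall t, jackson t \in windmills n}.
Proof.
move=> n8 [x [y z]]; rewrite mem_windmills => /and4P[x0 y0 z0 /eqP xyz].
have [xo yo zo] := windmill_odd n8 xyz.
(* In each branch the form x^2 + 2yz is preserved identically, and the tests give positivity, with
   parity excluding the boundary cases. *)
rewrite /jackson; do !case: ltP => ?; rewrite mem_windmills; apply/and4P;
  split; try lia; by rewrite -xyz; apply/eqP; ring.
Qed.

(** The first and the last branch are inverse to each other; each of the three middle branches maps
    its own region to itself. *)
Lemma jacksonK n : (n %% 8 = 3)%N -> {in windmills n, involutive jackson}.
Proof.
move=> n8 [x [y z]]; rewrite mem_windmills => /and4P[x0 y0 z0 /eqP xyz].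
have [xo yo zo] := windmill_odd n8 xyz.
have eq3 (a b c a' b' c' : int) : a = a' -> b = b' -> c = c' ->
    (a, (b, c)) = (a', (b', c')) by move=> -> -> ->.
rewrite /jackson; do !case: ltP => ?; try lia; apply: eq3; lia.
Qed.

Lemma jackson_fixed n x y z : (n %% 8 = 3)%N -> (x, (y, z)) \in windmills n ->
  (jackson (x, (y, z)) == (x, (y, z))) = (x == y).
Proof.
move=> n8; rewrite mem_windmills => /and4P[x0 y0 z0 /eqP xyz].
have [xo yo zo] := windmill_odd n8 xyz.
have [e nE] : exists e : int, n%:Z = 8 * e + 3 by exists (n %/ 8)%N; lia.
have [i xE] : exists i : int, x = 2 * i + 1 by exists (x %/ 2)%Z; lia.
have [k zE] : exists i : int, z = 2 * i + 1 by exists (z %/ 2)%Z; lia.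
apply/eqP/eqP => [|xy]; last first.
  by rewrite /jackson; do !case: ltP => ?; try lia; congr (_, (_, _)); lia.
rewrite /jackson; do !case: ltP => ?; case; try lia.
(* Only the fourth branch is left; a fixed point of the third would have y = x + z, against parity.
   Here y = 2x + z, so n = (x + 2z)^2 - 2z^2, which is 7 mod 8 since x + 2z = 2(i + z) + 1 and z are
   odd. *)
move=> *; have yE : y = 2 * x + z by lia.
have [w ww] : exists w, (i + z) * (i + z + 1) = 2 * w.
  have [v] : exists v, i + z = 2 * v \/ i + z = 2 * v + 1.
    by exists ((i + z) %/ 2)%Z; lia.
  by case=> ->; [exists (v * (2 * v + 1)) | exists ((2 * v + 1) * (v + 1))]; ring.
have : 4 * ((i + z) * (i + z + 1)) + 1 - 2 * z ^+ 2 = n%:Z.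
  by rewrite -xyz yE xE; ring.
by rewrite ww zE nE; nia.
Qed.

(** The predicates are there so that these lists count the terms in a product of two series [sqser].
    For positive c and d the search range 0..n misses no solution. *)
Definition sq_reps (c : nat) (P : pred nat) (d : nat) (Q : pred nat) (n : nat) :
    seq (nat * nat) :=
  [seq p <- [seq (i, j) | i <- iota 0 n.+1, j <- iota 0 n.+1] |
    [&& P p.1, Q p.2 & (c * p.1 ^ 2 + d * p.2 ^ 2 == n)%N]].

Lemma sq_reps_uniq c P d Q n : uniq (sq_reps c P d Q n).
Proof. by rewrite filter_uniq // allpairs_uniq ?iota_uniq // => -[? ?] [? ?]. Qed.

Lemma mem_sq_reps c P d Q n i j : (0 < c)%N -> (0 < d)%N ->
  ((i, j) \in sq_reps c P d Q n) = [&& P i, Q j & (c * i ^ 2 + d * j ^ 2 == n)%N].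
Proof.
move=> c0 d0; rewrite mem_filter andb_idr // => /and3P[_ _ /eqP].
rewrite [_.1]/= [_.2]/= => ij.
by apply/allpairsP; exists (i, j); rewrite !mem_iota /=; split=> //; nia.
Qed.

(** Exchanging y and z leaves the triples with y = z, that is, x^2 + 2y^2 = n. No solution of this
    has a zero entry: x = 0 would make n even, y = 0 would make it a square. *)
Lemma odd_windmills_reps n : (n %% 8 = 3)%N ->
  odd (size (windmills n)) = odd (size (sq_reps 1 xpredT 2 xpredT n)).
Proof.
move=> n8; pose swap (t : int * (int * int)) := (t.1, (t.2.2, t.2.1)).
rewrite (@odd_size_involution _ swap) ?windmills_uniq //; first last.
- by move=> [x [y z]].
- move=> [x [y z]]; rewrite !mem_windmills => /and4P[-> -> -> /eqP <-] /=.
  by apply/eqP; ring.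
congr odd; pose f (t : int * (int * int)) := (absz t.1, absz t.2.1).
pose g (p : nat * nat) : int * (int * int) := (p.1%:Z, (p.2%:Z, p.2%:Z)).
have memF x y z : ((x, (y, z)) \in [seq t <- windmills n | swap t == t]) =
  (y == z) && [&& 0 < x, 0 < y & x ^+ 2 + 2 * y ^+ 2 == n%:Z].
  rewrite mem_filter mem_windmills; apply/andP/andP => -[].
    by rewrite /swap => /eqP[_ <-] /and4P[-> -> _ /eqP <-]; split=> //; apply/eqP; ring.
  move=> /eqP <- /and3P[-> y0 /eqP <-]; rewrite /swap y0; split=> //.
  by apply/eqP; ring.
apply: (@size_bijection _ _ f g);
  rewrite ?sq_reps_uniq ?(filter_uniq _ (windmills_uniq n)) //.
- move=> [x [y z]]; rewrite memF => /andP[_ /and3P[x0 y0 /eqP xy]].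
  by rewrite /f mem_sq_reps //=; apply/eqP; nia.
- move=> [i j]; rewrite mem_sq_reps //= mul1n => /eqP ij; rewrite memF eqxx /=.
  have i0 : (i != 0)%N by apply: contra_eqN ij => /eqP ->; lia.
  have j0 : (j != 0)%N.
    by apply: contraTneq (nonsquare_mod8 i n8) => j0; rewrite negbK -ij j0; lia.
  by apply/and3P; split; [lia | lia | apply/eqP; nia].
- move=> [x [y z]]; rewrite memF => /andP[/eqP <- /and3P[x0 y0 _]].
  by rewrite /f /g /= !gtz0_abs.
- by move=> [i j].
Qed.

(** The fixed triples (x, (x, z)) of [jackson] are the factorizations n = x(x + 2z). They match the
    divisors d = x with d < n/d, the difference n/d - d being even as n is odd. *)
Lemma odd_windmills_divisors n : (n %% 8 = 3)%N ->
  odd (size (windmills n)) = odd (size [seq d <- divisors n | (d < n %/ d)%N]).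
Proof.
move=> n8; rewrite (@odd_size_involution _ jackson) ?windmills_uniq //; first last.
- exact: jacksonK.
- exact: jackson_windmills.
have n0 : (0 < n)%N by case: n n8.
congr odd; pose f (t : int * (int * int)) := absz t.1.
pose g d : int * (int * int) := (d%:Z, (d%:Z, ((n %/ d - d) %/ 2)%N%:Z)).
have memF x y z : ((x, (y, z)) \in [seq t <- windmills n | jackson t == t]) =
  (y == x) && [&& 0 < x, 0 < z & x * (x + 2 * z) == n%:Z].
  rewrite mem_filter andbC; apply/andP/andP => -[].
    move=> xyz; rewrite (jackson_fixed n8 xyz) => /eqP yE.
    move: xyz; rewrite -yE mem_windmills => /and4P[x0 _ z0 /eqP <-]; split=> //.
    by rewrite x0 z0; apply/eqP; ring.
  move=> /eqP -> /and3P[x0 z0 /eqP nE].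
  have H : (x, (x, z)) \in windmills n.
    by rewrite mem_windmills x0 z0 -nE /=; apply/eqP; ring.
  by rewrite (jackson_fixed n8 H) eqxx.
have fE (x z : int) : 0 < x -> 0 < z -> x * (x + 2 * z) = n%:Z ->
    (absz x %| n)%N /\ (n %/ absz x = absz x + 2 * absz z)%N.
  move=> x0 z0 nE; have nE' : n = ((absz x + 2 * absz z) * absz x)%N by nia.
  by rewrite nE' mulnK ?dvdn_mull //; lia.
apply: (@size_bijection _ _ f g);
  rewrite ?(filter_uniq _ (divisors_uniq n)) ?(filter_uniq _ (windmills_uniq n)) //.
- move=> [x [y z]]; rewrite memF => /andP[_ /and3P[x0 z0 /eqP /fE[]// dx nx]].
  by rewrite mem_filter -dvdn_divisors // /f /= dx nx; lia.
- move=> d; rewrite [d \in _]mem_filter -dvdn_divisors // => /andP[ltd /dvdnP[e nE]].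
  have d0 : (0 < d)%N by case: (d) nE n0 => //; lia.
  move: ltd; rewrite memF eqxx nE mulnK // => ltd.
  have [z eE] : exists z, e = (d + 2 * z)%N.
    have : odd (e * d) by lia.
    by rewrite oddM => /andP[oe od]; exists ((e - d) %/ 2)%N; lia.
  have -> : ((e - d) %/ 2 = z)%N by lia.
  by rewrite eE !PoszM !PoszD; apply/and3P; split; [lia | lia | apply/eqP; lia].
- move=> [x [y z]]; rewrite memF => /andP[/eqP -> /and3P[x0 z0 /eqP /fE[]// dx nx]].
  rewrite /f /g /= nx gtz0_abs //; congr (_, (_, _)); lia.
Qed.

(** * From an odd number of divisors below the square root to a prime times a square *)

Lemma odd_divisors_prime_mul_square n : (0 < n)%N -> (forall m, n != m ^ 2)%N ->
  odd (size [seq d <- divisors n | (d < n %/ d)%N]) ->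
  exists p m, prime p /\ n = (p * m ^ 2)%N.
Proof.
move=> n0 nsq.
have [/hasP[p pn lo]|] := boolP (has (fun p => odd (logn p n)) (primes n)); last first.
  (* If every prime had even exponent, n would be the square of the product of the half powers. *)
  move/hasPn => ev; case/negP: (nsq (\prod_(p <- primes n) p ^ (logn p n)./2)%N).
  rewrite (big_morph _ (fun x y => expnMn x y 2) (exp1n 2)).
  rewrite {1}(prod_prime_decomp n0) prime_decompE big_map /=; apply/eqP.
  apply: eq_big_seq => p /ev lp; rewrite -expnM muln2 -[in LHS](odd_double_half (logn p n)).
  by rewrite (negPf lp).
have pp : prime p by move: pn; rewrite mem_primes => /andP[].
(* [F d e] is d with its p-part replaced by that of e. Of the two new cofactors [s] takes the
   smaller, so that the result again lies below its cofactor; they differ because n is not a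
   square. *)
pose F d e := (d`_p^' * e`_p)%N; pose s d := minn (F d (n %/ d)%N) (F (n %/ d)%N d).
have dpos d e : (d * e = n)%N -> (0 < d)%N /\ (0 < e)%N.
  by move=> de; move: n0; rewrite -de muln_gt0 => /andP[].
have FM d e : (d * e = n)%N -> (F d e * F e d = n)%N.
  move=> de; have [d0 e0] := dpos _ _ de.
  transitivity ((d`_p * d`_p^') * (e`_p * e`_p^'))%N; last by rewrite !partnC.
  by rewrite /F; ring.
have FK d e : (d * e = n)%N -> F (F d e) (F e d) = d.
  move=> de; have [d0 e0] := dpos _ _ de.
  rewrite /F !partnM ?part_gt0 // -[RHS](partnC p d0) mulnC; congr (_ * _)%N.
    rewrite (part_p'nat (part_pnat _ _ : _.-nat _)) mul1n.
    by rewrite part_pnat_id ?part_pnat.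
  rewrite part_pnat_id ?part_pnat //.
  by rewrite [X in (_ * X)%N]part_p'nat ?muln1 // pnatNK part_pnat.
have sE d e : (d * e = n)%N -> s d = minn (F d e) (F e d).
  by move=> de; have [d0 _] := dpos _ _ de; rewrite /s -de mulKn.
have memS d : d \in [seq d <- divisors n | (d < n %/ d)%N] ->
    exists2 e, (d * e = n)%N & (d < e)%N.
  rewrite mem_filter -dvdn_divisors // => /andP[+ /dvdnP[e nE]]; rewrite nE in n0 *.
  by rewrite mulnK; [exists e => //; exact: mulnC | move: n0; rewrite muln_gt0 => /andP[]].
have inS d e : (d * e = n)%N -> (d < e)%N -> d \in [seq d <- divisors n | (d < n %/ d)%N].
  move=> de lt_de; have [d0 _] := dpos _ _ de.
  by rewrite mem_filter -dvdn_divisors // -de mulKn // lt_de dvdn_mulr.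
rewrite (@odd_size_involution _ s) ?(filter_uniq _ (divisors_uniq n)) //; first last.
- move=> d /memS[e de lt_de]; rewrite (sE _ _ de).
  have := FM _ _ de; have := FK _ _ de; have := FK e d.
  rewrite mulnC => /(_ de); set D := F d e; set E := F e d => EE DD DE.
  by case: (leqP D E) => _; rewrite (sE _ _ DE, sE E D) ?DD ?EE;
    [lia | lia | rewrite mulnC].
- move=> d /memS[e de lt_de]; rewrite (sE _ _ de).
  have := FM _ _ de; set D := F d e; set E := F e d => DE.
  case: (ltngtP D E) => [lt_DE|lt_ED|eqDE]; first exact: inS lt_DE.
    by apply: inS lt_ED; rewrite mulnC.
  by case/negP: (nsq D); rewrite -DE eqDE -mulnn.
case E: [seq _ <- _ | _] => [//|d r] _; have : d \in d :: r by rewrite mem_head.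
rewrite -E mem_filter => /andP[/eqP sd /memS[e de lt_de]].
have [d0 e0] := dpos _ _ de.
have lde : logn p n = (logn p d + logn p e)%N by rewrite -de lognM.
(* If [F d e] = d, then d and e have the same p-part and the exponent of p in n is even, a
   contradiction. If [F e d] = d, they have the same part prime to p, so n is an odd power of p
   times a square. *)
move: sd; rewrite (sE _ _ de) /F; case: leqP => _.
  rewrite -[RHS](partnC p d0) mulnC => /eqP; rewrite eqn_pmul2r ?part_gt0 //.
  rewrite !p_part eqn_exp2l ?prime_gt1 // => /eqP led.
  by move: lo; rewrite lde led addnn odd_double.
rewrite -[RHS](partnC p d0) mulnC => /eqP; rewrite eqn_pmul2l ?part_gt0 // => /eqP edp.
exists p, (p ^ (logn p n)./2 * d`_p^')%N; split=> //.
transitivity ((d`_p * d`_p^') * (e`_p * e`_p^'))%N; first by rewrite !partnC.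
rewrite edp mulnACA mulnn !p_part -expnD -lde.
have lE : logn p n = (logn p n)./2.*2.+1 by rewrite -[LHS]odd_double_half lo.
by rewrite {1}lE expnS expnMn -expnM muln2 mulnA.
Qed.

(** * Counting elements of Z[sqrt(-2)] of given norm *)

(* Elements x + y sqrt(-2) of norm m prime to 1 + sqrt(-2), up to sign: such an
   element has x <> y mod 3, and the congruence selects one of it and its
   opposite.  Multiplication by - (1 - sqrt(-2)) preserves the congruence. *)
Definition pi_reps (m : nat) : seq (int * int) :=
  [seq p <- ibox m | (p.1 ^+ 2 + 2 * p.2 ^+ 2 == m%:Z) && (3 %| p.1 - p.2 - 1)%Z].

Lemma pi_reps_uniq m : uniq (pi_reps m).
Proof. by rewrite filter_uniq ?ibox_uniq. Qed.

Lemma mem_pi_reps m (x y : int) : ((x, y) \in pi_reps m) =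
  (x ^+ 2 + 2 * y ^+ 2 == m%:Z) && (3 %| x - y - 1)%Z.
Proof.
rewrite mem_filter andb_idr // => /andP[]; rewrite [_.1]/= [_.2]/= => /eqP xy _.
by rewrite mem_ibox; apply/andP; split; nia.
Qed.

Lemma pi_repsP m (x y : int) : (x, y) \in pi_reps m ->
  x ^+ 2 + 2 * y ^+ 2 = m%:Z /\ exists s, x = y + 3 * s + 1.
Proof.
by rewrite mem_pi_reps => /andP[/eqP xy ?]; split=> //; exists ((x - y) %/ 3)%Z; lia.
Qed.

Lemma mod3_split (y : int) : exists w t : int, y = 3 * w + t /\ (t = 0 \/ t = 1 \/ t = 2).
Proof. by exists (y %/ 3)%Z, (y %% 3)%Z; lia. Qed.

(** [g] is multiplication by - (1 - sqrt(-2)), of norm 3, and [f] is division by it. The quotient is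
    integral: 3 dividing the norm, together with the congruence, forces y = 1 and x = 2 mod 3. *)
Lemma size_pi_repsM3 m : size (pi_reps (3 * m)) = size (pi_reps m).
Proof.
have fP x y : (x, y) \in pi_reps (3 * m) ->
    exists2 w, y = 3 * w + 1 & exists s, x = y + 3 * s + 1.
  move=> /pi_repsP[xyE [s xE]]; have [w [t [yE t012]]] := mod3_split y.
  by exists w; [subst x y; nia | exists s].
pose f (p : int * int) : int * int := (((2 * p.2 - p.1) %/ 3)%Z, - ((p.1 + p.2) %/ 3)%Z).
pose g (p : int * int) : int * int := (- p.1 - 2 * p.2, p.1 - p.2).
apply: (@size_bijection _ _ f g); rewrite ?pi_reps_uniq //.
- move=> [x y] xyP; have [w yE [s xE]] := fP _ _ xyP; have [xyE _] := pi_repsP xyP.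
  have -> : f (x, y) = (w - s, - (2 * w + 1 + s)).
    by rewrite /f; congr (_, _); rewrite /=; lia.
  rewrite mem_pi_reps; apply/andP; split; last by lia.
  by apply/eqP; subst x y; nia.
- move=> [u v] /pi_repsP[uvE [s uE]].
  by rewrite mem_pi_reps /= PoszM -uvE; apply/andP; split; [apply/eqP; ring | lia].
- move=> [x y] /fP[w yE [s xE]]; rewrite /f /g /=; congr (_, _); lia.
- move=> [u v] /pi_repsP[uvE [s uE]]; rewrite /f /g /=; congr (_, _); lia.
Qed.

(** [f] is conjugation, with the sign chosen to restore the congruence; here (x, y) is (1, 0) or (0,
    2) mod 3. As m is odd, x = 0 is impossible, so a fixed point has y = 0 and m = x^2, and the
    congruence determines the sign of x. *)
Lemma odd_size_pi_reps_coprime m : odd m -> ~~ (3 %| m)%N ->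
  reflect (exists k, m = k ^ 2)%N (odd (size (pi_reps m))).
Proof.
move=> om m3; pose f (p : int * int) := if (3 %| p.2)%Z then (p.1, - p.2) else (- p.1, p.2).
have resP x y : (x, y) \in pi_reps m -> exists u v,
    (x = 3 * u + 1 /\ y = 3 * v) \/ (x = 3 * u /\ y = 3 * v + 2).
  move=> /pi_repsP[xyE [s xE]]; have [w [t [yE t012]]] := mod3_split y.
  case: t012 => [tE|[tE|tE]].
  - by exists (w + s), w; left; lia.
  - by exfalso; subst x y t; nia.
  - by exists (w + s + 1), w; right; lia.
have fE x y : f (x, y) = if (3 %| y)%Z then (x, - y) else (- x, y) by [].
rewrite (@odd_size_involution _ f) ?pi_reps_uniq //; first last.
- move=> [x y] /resP[u [v [[xE yE]|[xE yE]]]].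
    by rewrite fE ifT ?fE ?ifT ?opprK //; lia.
  by rewrite fE ifF ?fE ?ifF ?opprK //; lia.
- move=> [x y] xyP; have [xyE _] := pi_repsP xyP.
  have [u [v [[xE yE]|[xE yE]]]] := resP _ _ xyP; rewrite fE.
    by rewrite ifT ?mem_pi_reps; [rewrite sqrrN xyE eqxx; lia | lia].
  by rewrite ifF ?mem_pi_reps; [rewrite sqrrN xyE eqxx; lia | lia].
have fixP x y : (x, y) \in [seq p <- pi_reps m | f p == p] ->
    y = 0 /\ exists u, x = 3 * u + 1.
  rewrite mem_filter => /andP[/eqP fxy xyP]; have [xyE _] := pi_repsP xyP.
  have [u [v [[xE yE]|[xE yE]]]] := resP _ _ xyP; move: fxy; rewrite fE.
    by rewrite ifT; [case; split; [lia | exists u] | lia].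
  rewrite ifF; last by lia.
  by case=> ?; exfalso; have x0 : x = 0 by [lia]; move: xyE; rewrite x0; lia.
rewrite odd_size_subsingleton ?(filter_uniq _ (pi_reps_uniq m)) //; last first.
  move=> [x y] [x' y'] xy xy'.
  have [y0 [u uE]] := fixP _ _ xy; have [y'0 [u' u'E]] := fixP _ _ xy'.
  move: xy xy'; rewrite mem_filter => /andP[_ /pi_repsP[e1 _]].
  rewrite mem_filter => /andP[_ /pi_repsP[e2 _]].
  move: e1 e2; rewrite y0 y'0 => e1 e2; congr (_, _).
  have /eqP : x ^+ 2 = x' ^+ 2 by lia.
  by rewrite eqf_sqr => /orP[] /eqP; lia.
apply: (iffP idP) => [|[k mE]].
  case E: [seq _ <- _ | _] => [//|[x y] r] _.
  have xy : (x, y) \in [seq p <- pi_reps m | f p == p] by rewrite E mem_head.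
  have [y0 [u uE]] := fixP _ _ xy.
  by move: xy; rewrite mem_filter => /andP[_ /pi_repsP[xyE _]]; exists (absz x); nia.
have k3 : ~~ (3 %| k)%N by apply: contra m3 => k3; rewrite mE dvdn_exp.
pose x : int := if (3 %| k%:Z - 1)%Z then k%:Z else - k%:Z.
suff : (x, 0) \in [seq p <- pi_reps m | f p == p] by case: [seq _ <- _ | _].
rewrite mem_filter fE dvdz0 oppr0 eqxx mem_pi_reps mE /x.
by case: ifP => h; rewrite ?sqrrN; apply/andP; split; lia.
Qed.

(** Factors 3 are removed in pairs, since 9 = 1 mod 8. If a single one remains, m = 3h with h = 3
    mod 8 prime to 3, and neither h nor m is a square. *)
Lemma odd_size_pi_reps m : (m %% 8 = 1)%N ->
  odd (size (pi_reps m)) <-> (exists k, m = k ^ 2)%N.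
Proof.
have [N] := ubnP m; elim: N m => // N IHN m /ltnSE leN m8.
have [|m3] := boolP (3 %| m)%N; last first.
  by apply: iff_sym; apply: rwP; apply: odd_size_pi_reps_coprime => //; lia.
case/dvdnP=> h mE; rewrite mE mulnC size_pi_repsM3.
have [|h3] := boolP (3 %| h)%N.
  case/dvdnP=> l hE; rewrite hE mulnC size_pi_repsM3.
  have /IHN lP : (l < N)%N by lia.
  have /lP -> : (l %% 8 = 1)%N by lia.
  split=> -[k kE]; first by exists (3 * k)%N; rewrite kE; lia.
  exists (k %/ 3)%N; have : (3 %| k ^ 2)%N by rewrite -kE dvdn_mulr.
  by rewrite Euclid_dvdX // => /andP[/dvdnP[r rE] _]; rewrite rE mulnK //; lia.
have oh : odd h by lia.
rewrite -(rwP (odd_size_pi_reps_coprime oh h3)); split=> -[k kE].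
  exfalso; have [q [r [kqr r8]]] : exists q r, (k = 8 * q + r)%N /\ (r < 8)%N.
    by exists (k %/ 8)%N, (k %% 8)%N; lia.
  have : (h = 8 * (8 * (q * q) + 2 * (q * r)) + r * r)%N by rewrite kE kqr; lia.
  by case: r r8 {kqr} => [|[|[|[|[|[|[|[|]]]]]]]] // _; lia.
have : (3 %| k ^ 2)%N by rewrite -kE dvdn_mulr.
rewrite Euclid_dvdX // => /andP[/dvdnP[r rE] _]; case/negP: h3.
by apply/dvdnP; exists (r ^ 2)%N; nia.
Qed.

Definition non3 (k : nat) := ~~ (3 %| k)%N.
Definition odd_non3 (k : nat) := odd k && non3 k.

(** A pair (i, j) forces m = 1 mod 8 and 3 | m. Under these conditions (i, 2j), with signs fixed
    modulo 3, runs through [pi_reps m], whose size is odd exactly when m is a square, necessarily of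
    the form (3k)^2 with k odd. *)
Lemma odd_size_sq_reps_1_8 m :
  odd (size (sq_reps 1 odd_non3 8 non3 m)) <->
  exists2 k : nat, odd k & m = (9 * k ^ 2)%N.
Proof.
have [/andP[/eqP m8 m3]|mN] := boolP ((m %% 8 == 1)%N && (3 %| m)%N); last first.
  have -> : sq_reps 1 odd_non3 8 non3 m = [::].
    case E: sq_reps => [//|[i j] r]; case/negP: mN.
    have : (i, j) \in sq_reps 1 odd_non3 8 non3 m by rewrite E mem_head.
    rewrite mem_sq_reps // => /and3P[/andP[oi i3] j3 /eqP ijE].
    have [t tE] := odd_sqr_mod8 oi.
    apply/andP; split; first by lia.
    have [w [a [iE a12]]] : exists w a, (i = 3 * w + a)%N /\ (a = 1%N \/ a = 2%N).
      by exists (i %/ 3)%N, (i %% 3)%N; move: i3; rewrite /non3; lia.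
    have [v [b [jE b12]]] : exists w a, (j = 3 * w + a)%N /\ (a = 1%N \/ a = 2%N).
      by exists (j %/ 3)%N, (j %% 3)%N; move: j3; rewrite /non3; lia.
    have -> : m = (3 * (3 * w * w + 2 * w * a + 24 * v * v + 16 * v * b)
        + a * a + 8 * b * b)%N.
      by rewrite -ijE iE jE; lia.
    by case: a12 b12 => [] -> [] ->; lia.
  split=> // -[k /odd_sqr_mod8[t tE] mE]; case/negP: mN; lia.
have -> : size (sq_reps 1 odd_non3 8 non3 m) = size (pi_reps m).
  (* [sg r k] is whichever of k and -k is r mod 3; the residues 2 and 1 give x - y = 1 mod 3. *)
  pose sg (r : int) (k : nat) : int := if (3 %| k%:Z - r)%Z then k%:Z else - k%:Z.
  pose f (p : nat * nat) : int * int := (sg 2 p.1, sg 1 (2 * p.2)%N).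
  pose g (p : int * int) : nat * nat := (absz p.1, absz p.2 %/ 2)%N.
  have sgK r k : absz (sg r k) = k by rewrite /sg; case: ifP; lia.
  have sg_sq r k : sg r k ^+ 2 = k%:Z ^+ 2 by rewrite /sg; case: ifP; rewrite ?sqrrN.
  have gP x y : (x, y) \in pi_reps m ->
      exists v, [/\ (x %% 3 = 2)%Z, (x %% 2 = 1)%Z, y = 2 * v, (v %% 3 = 2)%Z &
        x ^+ 2 + 8 * v ^+ 2 = m%:Z].
    move=> /pi_repsP[xyE [s xE]]; have [w [t [yE t012]]] := mod3_split y.
    have t1 : t = 1 by subst x y; case: t012 => [tE|[tE|tE]] //; subst t; nia.
    have [h [e [hE e01]]] : exists h e : int, x = 2 * h + e /\ (e = 0 \/ e = 1).
      by exists (x %/ 2)%Z, (x %% 2)%Z; lia.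
    have {e01}e1 : e = 1 by case: e01 => // e0; move: xyE; rewrite hE e0; lia.
    have [v [r [vE r01]]] : exists v r : int, y = 2 * v + r /\ (r = 0 \/ r = 1).
      by exists (y %/ 2)%Z, (y %% 2)%Z; lia.
    (* x is odd and m = 1 mod 8, so 2y^2 = 0 mod 8 and y is even; q makes x^2 = 1 mod 8 explicit. *)
    have {r01}r0 : r = 0.
      case: r01 => // r1; have [q qE] : exists q, h * (h + 1) = 2 * q.
        exists ((h * (h + 1)) %/ 2)%Z; have : (h * (h + 1) %% 2)%Z = 0.
          by rewrite -modzMm; have [|] : (h %% 2)%Z = 0 \/ (h %% 2)%Z = 1 by [lia];
            move=> hh; have -> : ((h + 1) %% 2)%Z = 1 - (h %% 2)%Z by [lia]; rewrite hh.
        by lia.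
      by exfalso; move: xyE; rewrite hE vE e1 r1; lia.
    exists v; split; [lia | lia | lia | lia | by move: xyE; rewrite vE r0; lia].
  apply: (@size_bijection _ _ f g); rewrite ?sq_reps_uniq ?pi_reps_uniq //.
  - move=> [i j]; rewrite mem_sq_reps // => /and3P[/andP[oi i3] j3 /eqP ijE].
    rewrite mem_pi_reps !sg_sq; apply/andP; split; first by apply/eqP; rewrite -ijE /=; lia.
    by move: i3 j3; rewrite /non3 /sg /=; do !case: ifP; lia.
  - move=> [x y] /gP[v [x3 x2 yE v3 xv]].
    have -> : g (x, y) = (absz x, absz v) by rewrite /g yE /=; congr (_, _); lia.
    rewrite mem_sq_reps //; apply/and3P; split; [| |apply/eqP; lia].
      by rewrite /odd_non3 /non3; apply/andP; split; lia.
    by rewrite /non3; lia.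
  - by move=> [i j] _; rewrite /f /g /= !sgK mulKn.
  - move=> [x y] /gP[v [x3 x2 yE v3 xv]]; rewrite /f /g /sg yE /=.
    by congr (_, _); case: ifP; lia.
rewrite odd_size_pi_reps //; split=> -[k].
  move=> kE; have : (3 %| k ^ 2)%N by rewrite -kE.
  rewrite Euclid_dvdX // => /andP[/dvdnP[r rE] _]; exists r; last by rewrite kE rE; lia.
  have : odd m by lia.
  by rewrite kE rE oddX oddM /= andbT.
by move=> ok ->; exists (3 * k)%N; lia.
Qed.

(** * Series over F_2 whose exponents are multiples of squares, and the powers of a *)

Lemma natF2E (k : nat) : k%:R = (odd k)%:R :> 'F_2.
Proof. by rewrite -{1}(odd_double_half k) natrD -mul2n natrM pchar_Zp // mul0r addr0. Qed.

Lemma natF2_eq1 (k : nat) : (k%:R = 1 :> 'F_2) <-> odd k.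
Proof. by rewrite natF2E; case: odd. Qed.

Lemma coef_laurentM (f g : laurent 'F_2) n : coefl (f * g) n = mull_coef f g n.
Proof. by []. Qed.

Lemma coef_laurentD (f g : laurent 'F_2) n : coefl (f + g) n = coefl f n + coefl g n.
Proof. by []. Qed.

Section SquareSeries.
Implicit Types (c d : nat) (P Q : pred nat).

(* [sqser c P] is the sum of the x^(c k^2) over k in P.  For c > 0 the exponents
   are distinct, so the 0/1 coefficients below are the right ones. *)
Definition sqser_coef c P (n : int) : 'F_2 :=
  `[< exists2 k : nat, P k & n = (c * k ^ 2)%N >]%:R.

Lemma sqser_bounded c P : bounded_below (sqser_coef c P).
Proof.
by exists 0 => n n0; rewrite /sqser_coef asboolF // => -[k _ nE]; move: n0; rewrite nE; lia.
Qed.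

Definition sqser c P : laurent 'F_2 := mkLaurent (sqser_bounded c P).

Lemma coef_sqser c P n :
  coefl (sqser c P) n = `[< exists2 k : nat, P k & n = (c * k ^ 2)%N >]%:R.
Proof. by []. Qed.

Lemma coef_sqser_neg c P n : n < 0 -> coefl (sqser c P) n = 0.
Proof.
by move=> n0; rewrite coef_sqser asboolF // => -[k _ nE]; move: n0; rewrite nE; lia.
Qed.

Lemma coef_sqser_sum c P N (i : nat) : (0 < c)%N -> (i < N)%N ->
  coefl (sqser c P) i%:Z = \sum_(k <- iota 0 N) (P k && (c * k ^ 2 == i)%N)%:R.
Proof.
move=> c0 iN; rewrite coef_sqser; case: asboolP => [[k Pk [iE]]|nex].
  rewrite (bigD1_seq k) ?iota_uniq ?mem_iota //=; last by nia.
  rewrite Pk iE eqxx big1 ?addr0 // => j jk.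
  by rewrite eqn_pmul2l // eqn_exp2r // (negPf jk) andbF.
rewrite big1_seq // => k _; case: andP => // -[Pk /eqP kE].
by case: nex; exists k; rewrite ?kE.
Qed.

Lemma coef_sqserM c P d Q n : (0 < c)%N -> (0 < d)%N ->
  coefl (sqser c P * sqser d Q) n%:Z = (size (sq_reps c P d Q n))%:R.
Proof.
(* [mull_coefE] expects the exponent as M + N + k; here M = N = 0. *)
move=> c0 d0; rewrite coef_laurentM -[n%:Z]add0r -[X in X + _](addr0 0).
rewrite mull_coefE; try exact: coef_sqser_neg.
under eq_bigr => i _.
  rewrite !add0r (@coef_sqser_sum _ _ n.+1) //.
  rewrite (@coef_sqser_sum _ _ n.+1) ?ltnS ?leq_subr //.
  rewrite big_distrlr /=.
  over.
rewrite exchange_big /=; under eq_bigr => k _ do rewrite exchange_big /=.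
rewrite size_filter -sum1_count natr_sum [RHS]big_mkcond big_allpairs.
apply: eq_bigr => k _; apply: eq_bigr => l _ /=.
case: and3P => [[Pk Ql /eqP klE]|nkl].
  have kn : (c * k ^ 2 < n.+1)%N by lia.
  have subE : (n - c * k ^ 2 = d * l ^ 2)%N by lia.
  rewrite (bigD1 (Ordinal kn)) //= Pk Ql eqxx subE eqxx mulr1 big1 ?addr0 // => j jk.
  case: eqP => [jE|_]; last by rewrite andbF mul0r.
  by case/eqP: jk; apply/val_inj.
rewrite big1 // => i _; case: andP => [[Pk /eqP kE]|_]; last by rewrite mul0r.
case: andP => [[Ql /eqP lE]|_]; last by rewrite mulr0.
by case: nkl; split=> //; rewrite kE lE subnKC // -ltnS.
Qed.

Lemma coef_sqserM_neg c P d Q n : n < 0 -> coefl (sqser c P * sqser d Q) n = 0.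
Proof.
move=> n0; rewrite coef_laurentM (@mull_coef0 _ _ _ 0 0) //; exact: coef_sqser_neg.
Qed.

(** Frobenius in characteristic 2: exchanging i and j cancels the cross terms and leaves the
    diagonal. *)
Lemma sqser_sqr c P : (0 < c)%N -> sqser c P ^+ 2 = sqser (2 * c) P.
Proof.
move=> c0; apply: laurent_eq => -[n|n]; rewrite expr2; last first.
  by rewrite coef_sqserM_neg // coef_sqser_neg.
rewrite coef_sqserM // natF2E coef_sqser; congr (nat_of_bool _)%:R.
pose s := sq_reps c P c P n; have us : uniq s := sq_reps_uniq _ _ _ _ _.
pose sw (p : nat * nat) := (p.2, p.1).
have swE i j : (sw (i, j) == (i, j)) = (i == j).
  by rewrite /sw xpair_eqE /= eq_sym andbb.
rewrite (@odd_size_involution _ sw) //; first last.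
- by move=> [i j].
- by move=> [i j]; rewrite !mem_sq_reps //= addnC andbCA.
have fixP i j : (i, j) \in [seq p <- s | sw p == p] ->
    [/\ i = j, P i & n = (2 * c * i ^ 2)%N].
  rewrite mem_filter swE mem_sq_reps // => /andP[/eqP <- /and3P[Pi _ /eqP <-]].
  by split=> //; lia.
rewrite odd_size_subsingleton ?(filter_uniq _ us) //; last first.
  move=> [i j] [i' j'] /fixP[<- _ nE] /fixP[<- _ nE'].
  have : (2 * c * i ^ 2 == 2 * c * i' ^ 2)%N by rewrite -nE -nE'.
  by rewrite eqn_pmul2l ?muln_gt0 // eqn_exp2r // => /eqP ->.
apply/idP/asboolP => [|[k Pk [nE]]].
  case E: [seq _ <- _ | _] => [//|[i j] r] _.
  by have [|_ Pi nE] := fixP i j; [rewrite E mem_head | exists i; rewrite ?nE].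
suff : (k, k) \in [seq p <- s | sw p == p] by case: [seq _ <- _ | _].
by rewrite mem_filter swE eqxx mem_sq_reps // Pk nE; apply/eqP; lia.
Qed.

End SquareSeries.

(** For k prime to 3, exactly one of k and -k is 1 mod 3. *)
Lemma thetaE : theta = sqser 1 non3.
Proof.
apply: laurent_eq => n; rewrite theta_coefE coef_sqser; congr (nat_of_bool _)%:R.
apply: asbool_equiv_eq; split=> [[k [k3 ->]]|[k k3 ->]].
  by exists (absz k); [rewrite /non3|]; lia.
have [h|h] := boolP (3 %| k%:Z - 1)%Z; [exists k%:Z | exists (- k%:Z)];
  move: k3; rewrite /non3; split; lia.
Qed.

Lemma theta4E : theta ^+ 4 = sqser 4 non3.
Proof. by rewrite thetaE (exprM _ 2 2) !sqser_sqr. Qed.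

Lemma theta8E : theta ^+ 8 = sqser 8 non3.
Proof. by rewrite (exprM _ 4 2) theta4E sqser_sqr. Qed.

(** An even k prime to 3 is 2h with h prime to 3, and k^2 = 4h^2: the even exponents of a are the
    exponents of a^4. *)
Lemma theta_split : theta = sqser 1 odd_non3 + theta ^+ 4.
Proof.
rewrite theta4E thetaE; apply: laurent_eq => n; rewrite coef_laurentD !coef_sqser.
have [[k k3 ->]|nex] := pselect (exists2 k, non3 k & n = (1 * k ^ 2)%N); last first.
  rewrite !asboolF ?addr0 // => -[k k3 nE]; apply: nex.
    by exists (2 * k)%N; [move: k3; rewrite /non3 | rewrite nE]; lia.
  by exists k; [case/andP: k3 | ].
rewrite (asboolT (_ : exists2 _, _ & _)); last by exists k.
have [ok|ek] := boolP (odd k).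
  rewrite asboolT; last by exists k; rewrite ?/odd_non3 ?ok.
  rewrite asboolF ?addr0 // => -[j _ [jE]].
  have : odd (1 * k ^ 2) by rewrite mul1n oddX ok.
  by rewrite jE oddM.
rewrite asboolF ?add0r; last first.
  move=> [j /andP[oj _] [jE]]; have : odd (1 * j ^ 2) by rewrite mul1n oddX oj.
  by rewrite -jE mul1n oddX (negPf ek).
rewrite asboolT //; have [h hE] : exists h, (k = 2 * h)%N by exists (k %/ 2)%N; lia.
exists h; last by rewrite hE; congr Posz; lia.
by move: k3; rewrite /non3 hE; lia.
Qed.

Lemma mul_odd_part_theta8 : sqser 1 odd_non3 * theta ^+ 8 = sqser 9 odd.
Proof.
rewrite theta8E; apply: laurent_eq => -[n|n]; last first.
  by rewrite coef_sqserM_neg // coef_sqser_neg.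
rewrite coef_sqserM // natF2E coef_sqser; congr (nat_of_bool _)%:R.
apply/idP/asboolP => [/odd_size_sq_reps_1_8[k ok ->]|[k ok [nE]]]; first by exists k.
by apply/odd_size_sq_reps_1_8; exists k.
Qed.

(** * Exponents in residue classes, and the part of 1/a in the class 3 mod 8 *)

Section Residues.
Variable F : fieldType.
Implicit Types (f g h : laurent F) (j : int).

Definition supp_mod (d j : int) f := forall n, coefl f n != 0 -> (d %| n - j)%Z.

Lemma supp_mod_coef0 d j f n : supp_mod d j f -> ~~ (d %| n - j)%Z -> coefl f n = 0.
Proof. by move=> fj; apply: contraNeq => /fj. Qed.

Lemma supp_modD d j f g : supp_mod d j f -> supp_mod d j g -> supp_mod d j (f + g).
Proof.
move=> fj gj n; have [/eqP f0|/fj //] := boolP (coefl f n == 0).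
by rewrite /= f0 add0r; apply: gj.
Qed.

Lemma supp_modM d j1 j2 f g :
  supp_mod d j1 f -> supp_mod d j2 g -> supp_mod d (j1 + j2) (f * g).
Proof.
move=> fj gj n; apply: contra_neqT => nj; apply: fsbig1 => i _.
have [-> |/fj fi] := eqVneq (coefl f i) 0; first exact: mul0r.
have [-> |/gj gi] := eqVneq (coefl g (n - i)) 0; first exact: mulr0.
have nE : n - (j1 + j2) = (i - j1) + (n - i - j2) by ring.
by case/negP: nj; rewrite nE rpredD.
Qed.

Lemma supp_modW d e j f : (e %| d)%Z -> supp_mod d j f -> supp_mod e j f.
Proof. by move=> ed fj n /fj; apply: dvdz_trans. Qed.

Definition sec_coef (d j : int) f (n : int) : F := if (d %| n - j)%Z then coefl f n else 0.

Lemma sec_bounded d j f : bounded_below (sec_coef d j f).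
Proof.
by have [N fN] := coeflP f; exists N => n /fN; rewrite /sec_coef => ->; case: ifP.
Qed.

Definition sec d j f := mkLaurent (sec_bounded d j f).

(** Multiplying by a series in x^d and its inverse moves no term to another residue class mod d. *)
Lemma secM d j f g : supp_mod d 0 g -> sec d j (f * g) = sec d j f * g.
Proof.
move=> g0; apply: laurent_eq => n; rewrite /= /sec_coef.
transitivity (mull_coef (sec d j f) g n) => //; rewrite /mull_coef /= /sec_coef.
case: ifP => [nj|/negbT nj]; [apply: eq_fsbigr => i _ | apply/esym/fsbig1 => i _].
  have [-> |/g0] := eqVneq (coefl g (n - i)) 0; first by rewrite !mulr0.
  rewrite subr0 => ni; rewrite ifT //.
  have -> : i - j = (n - j) - (n - i) by ring.
  exact: rpredB.
have [-> |/g0] := eqVneq (coefl g (n - i)) 0; first exact: mulr0.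
rewrite subr0 => ni; rewrite ifF ?mul0r //; apply: contraNF nj => ij.
have -> : n - j = (i - j) + (n - i) by ring.
exact: rpredD.
Qed.

End Residues.

Lemma laurentF2_addrr (f : laurent 'F_2) : f + f = 0.
Proof.
by apply: laurent_eq => n; rewrite coef_laurentD addrr_pchar2 // pchar_Fp.
Qed.

Lemma supp_mod_sqser (d j c : nat) (P : pred nat) :
  (forall k, P k -> c * k ^ 2 = j %[mod d])%N -> supp_mod d j (sqser c P).
Proof.
move=> cP n; rewrite coef_sqser; case: asboolP => [[k /cP kj ->] _|]; last by rewrite eqxx.
by rewrite -eqz_mod_dvd !modz_nat kj.
Qed.

Lemma theta_neq0 : theta != 0.
Proof.
apply/eqP => /(congr1 (fun f => coefl f 1)); rewrite thetaE coef_sqser asboolT.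
  by move/eqP; rewrite oner_eq0.
by exists 1%N.
Qed.

(** The difference of 1/a and the predicted part g = o^3 a^8 is multiplied by a^8, whose exponents
    are multiples of 8. The product has no exponent 3 mod 8, so neither has the difference, because
    a^8 can be cancelled in the field. *)
Lemma coef_theta_inv (n : int) : (8 %| n - 3)%Z ->
  coefl theta^-1 n = coefl (sqser 2 odd_non3 * sqser 9 odd) n.
Proof.
move=> n3; set o := sqser 1 odd_non3; pose u := theta ^+ 4.
have <- : o ^+ 2 = sqser 2 odd_non3 by rewrite sqser_sqr.
rewrite -mul_odd_part_theta8 -/o; pose g := o ^+ 2 * (o * theta ^+ 8).
have u2 : u ^+ 2 = theta ^+ 8 by rewrite -exprM.
have sqD (a b : laurent 'F_2) : (a + b) ^+ 2 = a ^+ 2 + b ^+ 2.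
  by rewrite sqrrD mulr2n laurentF2_addrr addr0.
have o1 : supp_mod 8 1 o.
  by apply: (@supp_mod_sqser 8 1) => k /andP[/odd_sqr_mod8[t ->] _]; lia.
have o2 : supp_mod 8 2 (o ^+ 2) by apply: (supp_modM o1 o1).
have o4 : supp_mod 8 4 (o ^+ 4) by rewrite (exprM _ 2 2); apply: (supp_modM o2 o2).
have u20 : supp_mod 8 0 (u ^+ 2).
  by rewrite u2 theta8E; apply: (@supp_mod_sqser 8 0) => k _; lia.
have u40 : supp_mod 8 0 (u ^+ 4) by rewrite (exprM _ 2 2); apply: (supp_modM u20 u20).
have u0 : supp_mod 2 0 u.
  by rewrite /u theta4E; apply: (@supp_mod_sqser 2 0) => k _; lia.
have W (j : int) (f : laurent 'F_2) : supp_mod 8 j f -> supp_mod 2 j f by apply: supp_modW.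
have ev : supp_mod 2 0 (u * ((o ^+ 2 + u ^+ 2) * (o ^+ 4 + u ^+ 4))).
  apply: (@supp_modM _ 2 0 0) => //; apply: (@supp_modM _ 2 0 0); apply: supp_modD.
  - by move=> k /(W _ _ o2); lia.
  - exact: W.
  - by move=> k /(W _ _ o4); lia.
  - exact: W.
(* This is a^7 = (o + u)(o^2 + u^2)(o^4 + u^4) without the term o^3 u^4 = g u^2. The terms on the
   right have exponents 7, 5 and 1 mod 8, and even ones. *)
have eqE : (theta^-1 - g) * u ^+ 2 =
    o * (o ^+ 2 * o ^+ 4) + o * (u ^+ 2 * o ^+ 4) + o * (u ^+ 2 * u ^+ 4)
    + u * ((o ^+ 2 + u ^+ 2) * (o ^+ 4 + u ^+ 4)).
  have t7 : theta^-1 * u ^+ 2 = theta * (theta ^+ 2 * theta ^+ 4).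
    by rewrite u2 (exprS theta 7) (mulrA theta^-1) mulVf ?theta_neq0 // mul1r -exprD -exprS.
  rewrite mulrBl t7 (exprM _ 2 2) {1 2 3}theta_split -/o -/u !sqD /g -u2 -!exprM.
  by ring.
have h0 m : (8 %| m - 3)%Z -> coefl ((theta^-1 - g) * u ^+ 2) m = 0.
  move=> m3; rewrite eqE !coef_laurentD.
  rewrite (supp_mod_coef0 (supp_modM o1 (supp_modM o2 o4))); last by lia.
  rewrite (supp_mod_coef0 (supp_modM o1 (supp_modM u20 o4))); last by lia.
  rewrite (supp_mod_coef0 (supp_modM o1 (supp_modM u20 u40))); last by lia.
  by rewrite (supp_mod_coef0 ev) ?addr0 //; lia.
have : sec 8 3 (theta^-1 - g) * u ^+ 2 = 0.
  rewrite -secM //; apply: laurent_eq => m; rewrite [LHS]/= /sec_coef.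
  by case: ifP => // /h0.
move/eqP; rewrite mulf_eq0 -exprM expf_eq0 (negPf theta_neq0) orbF => /eqP.
move/(congr1 (fun f => coefl f n)); rewrite /= /sec_coef n3 => /eqP.
by rewrite coef_laurentD addr_eq0 => /eqP ->; rewrite [coefl (- _) n]/= opprK.
Qed.

(** * Passage to pairs of perfect squares, and the conclusion *)

Lemma square_pairs_card (n : nat) :
  [set s : int * int | [/\ perfect_square s.1, perfect_square s.2 & s.1 + 2 * s.2 = n%:Z]]
    #= `I_(size (sq_reps 1 xpredT 2 xpredT n)).
Proof.
pose r := sq_reps 1 xpredT 2 xpredT n.
pose sq (p : nat * nat) : int * int := ((p.1 ^ 2)%N%:Z, (p.2 ^ 2)%N%:Z).
have sq_inj : injective sq.
  move=> [i j] [k l] [/eqP + /eqP]; rewrite !eqn_exp2r // => /eqP -> /eqP ->.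
  by [].
have -> : [set s : int * int | [/\ perfect_square s.1, perfect_square s.2
                                 & s.1 + 2 * s.2 = n%:Z]]
    = [set` [fset s in map sq r]%fset].
  apply/seteqP; split=> -[s1 s2] /=; rewrite in_fset /=.
    move=> [[i ->] [j ->] ijE]; apply/mapP; exists (absz i, absz j).
      by rewrite mem_sq_reps //; apply/eqP; lia.
    by rewrite /sq /=; congr (_, _); lia.
  case/mapP => -[i j]; rewrite mem_sq_reps // => /eqP ijE [-> ->].
  by split; [exists i%:Z | exists j%:Z |]; lia.
by apply/card_eq_fsetP; rewrite card_fseq undup_id ?size_map ?map_inj_uniq ?sq_reps_uniq.
Qed.

(** In i^2 + 2j^2 = n, the residue 2 mod 3 forces 3 | i and 3 prime to j. Modulo 8, i is odd, and an
    even j would give n = 1. So i = 3k with k odd. *)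
Lemma size_sq_reps_2_9 n : (n %% 8 = 3)%N -> (n %% 3 = 2)%N ->
  size (sq_reps 2 odd_non3 9 odd n) = size (sq_reps 1 xpredT 2 xpredT n).
Proof.
move=> n8 n3; pose f (p : nat * nat) := (3 * p.2, p.1)%N.
pose g (p : nat * nat) := (p.2, p.1 %/ 3)%N.
have gP i j : (i, j) \in sq_reps 1 xpredT 2 xpredT n ->
    exists k, [/\ i = (3 * k)%N, odd k, odd_non3 j & (9 * k ^ 2 + 2 * j ^ 2 = n)%N].
  rewrite mem_sq_reps // => /eqP ijE.
  have [w [a [iE a3]]] : exists w a, (i = 3 * w + a)%N /\ (a < 3)%N.
    by exists (i %/ 3)%N, (i %% 3)%N; lia.
  have [v [b [jE b3]]] : exists w a, (j = 3 * w + a)%N /\ (a < 3)%N.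
    by exists (j %/ 3)%N, (j %% 3)%N; lia.
  have nE : n = (3 * (3 * w * w + 2 * w * a + 6 * v * v + 4 * v * b) + a * a + 2 * b * b)%N.
    by rewrite -ijE iE jE; lia.
  have [a0 b0] : a = 0%N /\ b <> 0%N.
    by case: a b a3 b3 nE {iE jE} => [|[|[|]]] // [|[|[|]]] // _ _ nE; split=> //; lia.
  have oi : odd i.
    have : odd (1 * i ^ 2 + 2 * j ^ 2) by lia.
    by rewrite mul1n oddD oddX oddM; lia.
  have oj : odd j.
    apply: contraT => ej; have [t tE] := odd_sqr_mod8 oi.
    have [l lE] : exists l, j = (2 * l)%N by exists (j %/ 2)%N; lia.
    by move: ijE; rewrite lE mul1n tE; lia.
  exists w; split; [lia | lia | by rewrite /odd_non3 /non3 oj jE; lia |].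
  by rewrite -ijE iE a0; lia.
apply: (@size_bijection _ _ f g); rewrite ?sq_reps_uniq //.
- move=> [i j]; rewrite !mem_sq_reps // => /and3P[_ _ /eqP <-].
  by apply/eqP; rewrite /=; lia.
- move=> [i j] /gP[k [-> ok oj ijE]].
  by rewrite /g /= mulKn // mem_sq_reps // ok oj; apply/eqP; lia.
- by move=> [i j] _; rewrite /f /g /= mulKn.
- by move=> [i j] /gP[k [-> _ _ _]]; rewrite /f /g /= mulKn.
Qed.

Theorem theorem2p8 (n : int) (hn8 : (n = 3 %[mod 8])%Z) (hnB : Bset theta n) :
  (exists k : nat, odd k /\
     [set s : int * int | [/\ perfect_square s.1, perfect_square s.2
                            & s.1 + 2 * s.2 = n]] #= `I_k) /\
  (exists (p : nat) (m : int), prime p /\ n = p%:Z * m ^+ 2).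
Proof.
have n3 : (8 %| n - 3)%Z by lia.
have := coef_theta_inv n3; rewrite (hnB : coefl theta^-1 n = 1).
case: n hn8 n3 {hnB} => [n|n] hn8 n3; last first.
  by rewrite coef_sqserM_neg // => /eqP; rewrite oner_eq0.
rewrite coef_sqserM // => /esym/natF2_eq1 odd_r.
have n8 : (n %% 8 = 3)%N by lia.
(* An odd count provides a solution of 2i^2 + 9j^2 = n with i prime to 3, and then i^2 = 1 mod 3. *)
have nmod3 : (n %% 3 = 2)%N.
  case E: sq_reps odd_r => [//|[i j] r] _.
  have : (i, j) \in sq_reps 2 odd_non3 9 odd n by rewrite E mem_head.
  rewrite mem_sq_reps // /odd_non3 /non3 => /and3P[/andP[_ i3] _ /eqP ijE].
  have [w [a [iE a12]]] : exists w a, (i = 3 * w + a)%N /\ (a = 1%N \/ a = 2%N).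
    by exists (i %/ 3)%N, (i %% 3)%N; lia.
  have : n = (3 * (6 * w * w + 4 * w * a + 3 * j ^ 2) + 2 * (a * a))%N.
    by rewrite -ijE iE; lia.
  by case: a12 => ->; lia.
rewrite size_sq_reps_2_9 // in odd_r; split.
  by exists (size (sq_reps 1 xpredT 2 xpredT n)); split=> //; exact: square_pairs_card.
rewrite -odd_windmills_reps // odd_windmills_divisors // in odd_r.
have n0 : (0 < n)%N by lia.
have [p [m [pp nE]]] :=
  odd_divisors_prime_mul_square n0 (fun m => nonsquare_mod8 m n8) odd_r.
by exists p, m%:Z; split=> //; rewrite nE; lia.
Qed.
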